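(* Let $K$ be an algebraically closed field of characteristic $0$, let $(V,\rho)$ be a strictly indecomposable representation of the braid group $B_3$ over $K$ with $\dim(V)=n=3$, and let $W$ be a non-zero invariant subspace of $V$ of minimal dimension. Suppose $\dim(W)=2$. Then, up to equivalence, the matrices $A$ of $\rho(\sigma_1)$ and $B$ of $\rho(\sigma_2)$ have one of the following forms, where in each case the $\lambda_i\in K$ that occur are non-zero and distinct: (1) $A=\begin{pmatrix}\lambda_1&0&0\\0&\lambda_2&0\\0&0&\lambda_3\end{pmatrix}$, $B=\begin{pmatrix}\frac{\lambda_2^3}{\lambda_2^2+\lambda_3^2}&1&1\\\frac{\lambda_3^2(\lambda_2^4+\lambda_2^2\lambda_3^2+\lambda_3^4)}{(\lambda_2^2+\lambda_3^2)^2}&-\frac{\lambda_3^4}{\lambda_2(\lambda_2^2+\lambda_3^2)}&-\frac{\lambda_3^3(\lambda_2^2+\lambda_2\lambda_3+\lambda_3^2)}{\lambda_2^2(\lambda_2^2+\lambda_3^2)}\\0&0&\lambda_3\end{pmatrix}$, with $\lambda_1=-\frac{\lambda_3^2}{\lambda_2}$ and $\lambda_1^2-\lambda_1\lambda_2+\lambda_2^2\neq0$; or equivalently (under the same conditions on the $\lambda_i$, this pair is equivalent to) $A=\begin{pmatrix}\lambda_2&\lambda_2&0\\0&\lambda_1&0\\0&0&\lambda_3\end{pmatrix}$, $B=\begin{pmatrix}\lambda_1&0&\frac{\lambda_3^2-(\lambda_1-\lambda_2)\lambda_3+\lambda_2^2}{\lambda_2^2+\lambda_3^2}\\-\lambda_1&\lambda_2&-1\\0&0&\lambda_3\end{pmatrix}$.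 (2) $A=\begin{pmatrix}\lambda_1&1&0\\0&\lambda_1&0\\0&0&\lambda_2\end{pmatrix}$, $B=\begin{pmatrix}2\lambda_1&1&\frac{2\lambda_1+\lambda_2}{\lambda_2^2}\\\lambda_2^2&0&1\\0&0&\lambda_2\end{pmatrix}$, with $\lambda_1=\lambda_2e^{\pm\pi i/2}$; or equivalently (under the same condition, this pair is equivalent to) $A=\begin{pmatrix}\lambda_1&\lambda_1&0\\0&\lambda_1&0\\0&0&\lambda_2\end{pmatrix}$, $B=\begin{pmatrix}\lambda_1&0&1+\frac{\lambda_1}{\lambda_2}\\-\lambda_1&\lambda_1&\frac{\lambda_2}{\lambda_1}\\0&0&\lambda_2\end{pmatrix}$. (3) $A=\begin{pmatrix}\lambda_1&0&0\\0&\lambda_2&1\\0&0&\lambda_2\end{pmatrix}$, $B=\begin{pmatrix}\frac{\lambda_2}{2}&1&0\\\frac{3\lambda_2^2}{4}&-\frac{\lambda_2}{2}&-2\\0&0&\lambda_2\end{pmatrix}$, with $\lambda_1=-\lambda_2$; or equivalently (under the same condition, this pair is equivalent to) $A=\begin{pmatrix}\lambda_1&\lambda_1&1\\0&\lambda_2&-2\\0&0&\lambda_2\end{pmatrix}$, $B=\begin{pmatrix}\lambda_2&0&-2\\-\lambda_2&\lambda_1&4\\0&0&\lambda_2\end{pmatrix}$.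
   Context: The braid group $B_3$ is the group generated by $\sigma_1,\sigma_2$ subject to the relation $\sigma_1\sigma_2\sigma_1=\sigma_2\sigma_1\sigma_2$. A representation is decomposable if it is the direct sum of two proper non-zero invariant subspaces, and indecomposable otherwise; it is irreducible if its only invariant subspaces are $0$ and $V$. A representation is strictly indecomposable if it is indecomposable but not irreducible. Invariant subspace means invariant under both $\rho(\sigma_1)$ and $\rho(\sigma_2)$. Equivalence of representations means simultaneous conjugation of the matrices $A,B$ by an invertible matrix over $K$. The symbols $e^{\pm\pi i/2}$ denote the two primitive fourth roots of unity in $K$; either choice of sign is allowed. *)

(* Defs.v *)
From HB Require Import structures.
From mathcomp Require Import all_boot all_order all_algebra.
From mathcomp Require Import generic_quotient boolp.

Set Implicit Arguments.
Unset Strict Implicit.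
Unset Printing Implicit Defensive.

Import GRing.Theory.

(* The braid group B_3, as words in the letters sigma_1^{+-1}, sigma_2^{+-1}
   modulo the congruence generated by free cancellation and the braid relation.
   The letter (i, e) is sigma_1 if i = false and sigma_2 if i = true, inverted
   when e = true. *)
Definition letter : Type := (bool * bool)%type.
Definition letterV (a : letter) : letter := (a.1, ~~ a.2).
Definition word : Type := seq letter.

Definition s1 : letter := (false, false).
Definition s2 : letter := (true, false).

Inductive word_eq : word -> word -> Prop :=
| word_eq_refl u : word_eq u u
| word_eq_sym u v : word_eq u v -> word_eq v u
| word_eq_trans u v w : word_eq u v -> word_eq v w -> word_eq u w
| word_eq_cancel u v a : word_eq (u ++ [:: a; letterV a] ++ v) (u ++ v)
| word_eq_braid u v :
    word_eq (u ++ [:: s1; s2; s1] ++ v) (u ++ [:: s2; s1; s2] ++ v).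

Definition word_eqb : rel word := fun u v => `[< word_eq u v >].

Lemma word_eqb_refl : reflexive word_eqb.
Proof. by move=> u; apply/asboolP; apply: word_eq_refl. Qed.

Lemma word_eqb_sym : symmetric word_eqb.
Proof.
by move=> u v; apply/asboolP/asboolP => h; apply: word_eq_sym.
Qed.

Lemma word_eqb_trans : transitive word_eqb.
Proof.
move=> v u w /asboolP uv /asboolP vw; apply/asboolP.
exact: word_eq_trans uv vw.
Qed.

Canonical word_equiv :=
  EquivRel word_eqb word_eqb_refl word_eqb_sym word_eqb_trans.

Definition B3 : Type := {eq_quot word_eqb}%qT.
HB.instance Definition _ := Choice.on B3.

Definition B3_of (u : word) : B3 := (\pi_({eq_quot word_eqb}) u)%qT.

Lemma B3_ofP u v : B3_of u = B3_of v <-> word_eq u v.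
Proof.
rewrite /B3_of; split => [/eqquotP /asboolP //|h].
by apply/eqquotP/asboolP.
Qed.

Definition B3_rep (x : B3) : word := repr (x : {eq_quot word_eqb}%qT).

Lemma B3_repK x : B3_of (B3_rep x) = x.
Proof. exact: reprK. Qed.

Lemma word_eq_rep u : word_eq (B3_rep (B3_of u)) u.
Proof. by apply/B3_ofP; rewrite B3_repK. Qed.

Lemma word_eq_catl w u v : word_eq u v -> word_eq (w ++ u) (w ++ v).
Proof.
elim=> {u v} [u|u v _ h|u v t _ h _ h'|u v a|u v].
- exact: word_eq_refl.
- exact: word_eq_sym.
- exact: word_eq_trans h h'.
- by rewrite [w ++ (u ++ _)]catA [w ++ (u ++ v)]catA; apply: word_eq_cancel.
- by rewrite [w ++ (u ++ _)]catA [w ++ (u ++ _)]catA; apply: word_eq_braid.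
Qed.

Lemma word_eq_catr w u v : word_eq u v -> word_eq (u ++ w) (v ++ w).
Proof.
elim=> {u v} [u|u v _ h|u v t _ h _ h'|u v a|u v].
- exact: word_eq_refl.
- exact: word_eq_sym.
- exact: word_eq_trans h h'.
- by rewrite -!catA; apply: word_eq_cancel.
- by rewrite -!catA; apply: word_eq_braid.
Qed.

Lemma word_eq_cat u u' v v' :
  word_eq u u' -> word_eq v v' -> word_eq (u ++ v) (u' ++ v').
Proof.
move=> hu hv.
exact: word_eq_trans (word_eq_catr v hu) (word_eq_catl u' hv).
Qed.

Lemma letterVK : involutive letterV.
Proof. by case=> i e; rewrite /letterV /= negbK. Qed.

Definition wordV (u : word) : word := rev (map letterV u).

Lemma wordVM u v : wordV (u ++ v) = wordV v ++ wordV u.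
Proof. by rewrite /wordV map_cat rev_cat. Qed.

Lemma word_mulVw u : word_eq (wordV u ++ u) [::].
Proof.
elim: u => [|a u ih]; first exact: word_eq_refl.
rewrite -[a :: u]/([:: a] ++ u) wordVM -catA.
apply: word_eq_trans ih.
have := word_eq_cancel (wordV u) u (letterV a).
by rewrite letterVK.
Qed.

Lemma word_mulwV u : word_eq (u ++ wordV u) [::].
Proof.
have -> : u ++ wordV u = wordV (wordV u) ++ wordV u.
  congr (_ ++ _); rewrite /wordV map_rev revK -map_comp.
  by rewrite -[LHS]map_id; apply: eq_map => a /=; rewrite letterVK.
exact: word_mulVw.
Qed.

Definition B3_mul (x y : B3) : B3 := B3_of (B3_rep x ++ B3_rep y).
Definition B3_one : B3 := B3_of [::].
Definition B3_inv (x : B3) : B3 := B3_of (wordV (B3_rep x)).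

Lemma B3_mul_of u v : B3_mul (B3_of u) (B3_of v) = B3_of (u ++ v).
Proof. by apply/B3_ofP/word_eq_cat; apply: word_eq_rep. Qed.

Lemma B3_mulA : associative B3_mul.
Proof.
move=> x y z; rewrite -[x]B3_repK -[y]B3_repK -[z]B3_repK.
by rewrite !B3_mul_of catA.
Qed.

Lemma B3_mul1 : left_id B3_one B3_mul.
Proof. by move=> x; rewrite -[x]B3_repK B3_mul_of. Qed.

Lemma B3_mulr1 : right_id B3_one B3_mul.
Proof. by move=> x; rewrite -[x]B3_repK B3_mul_of cats0. Qed.

Lemma B3_mulV : left_inverse B3_one B3_inv B3_mul.
Proof.
move=> x; rewrite -{2}[x]B3_repK B3_mul_of.
exact/B3_ofP/word_mulVw.
Qed.

Lemma B3_mulrV : right_inverse B3_one B3_inv B3_mul.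
Proof.
move=> x; rewrite -{1}[x]B3_repK B3_mul_of.
exact/B3_ofP/word_mulwV.
Qed.

HB.instance Definition _ :=
  isGroup.Build B3 B3_mulA B3_mul1 B3_mulr1 B3_mulV B3_mulrV.

Definition sigma1 : B3 := B3_of [:: s1].
Definition sigma2 : B3 := B3_of [:: s2].

Lemma B3_braid : (sigma1 * sigma2 * sigma1 = sigma2 * sigma1 * sigma2)%g.
Proof.
rewrite /sigma1 /sigma2.
have mulE u v : (B3_of u * B3_of v)%g = B3_of (u ++ v) by exact: B3_mul_of.
by rewrite !mulE; apply/B3_ofP; apply: (word_eq_braid [::] [::]).
Qed.

Local Open Scope ring_scope.

Section Representations.
Variables (K : fieldType) (V : vectType K).
Implicit Types (rho : B3 -> 'End(V)) (U W : {vspace V}).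

(* Invertibility of each rho g follows, B3 being a group. *)
Definition is_representation rho : Prop :=
  rho 1%g = \1%VF /\ forall x y, rho (x * y)%g = (rho x \o rho y)%VF.

Definition invariant rho U : Prop :=
  (rho sigma1 @: U <= U)%VS /\ (rho sigma2 @: U <= U)%VS.

Definition irreducible rho : Prop :=
  fullv != 0%VS :> {vspace V} /\
  forall U, invariant rho U -> U = 0%VS \/ U = fullv.

Definition decomposable rho : Prop :=
  exists U W,
    [/\ invariant rho U /\ invariant rho W,
        U != 0%VS /\ U != fullv,
        W != 0%VS /\ W != fullv &
        (U + W)%VS = fullv /\ (U :&: W)%VS = 0%VS].

Definition strictly_indecomposable rho : Prop :=
  ~ decomposable rho /\ ~ irreducible rho.

Definition min_invariant rho W : Prop :=
  [/\ invariant rho W, W != 0%VS &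
      forall U, invariant rho U -> U != 0%VS -> (\dim W <= \dim U)%N].

(* Column convention: f e_j = \sum_i (end_mx e f i j) e_i; this is the
   transpose of mxof e e f. *)
Definition end_mx n (e : n.-tuple V) (f : 'End(V)) : 'M[K]_n :=
  \matrix_(i, j) coord e i (f e`_j).

End Representations.

Definition equivalent_pairs (K : fieldType) n (X Y : 'M[K]_n * 'M[K]_n) : Prop :=
  exists2 P : 'M[K]_n, P \in unitmx &
    X.1 = P *m Y.1 *m invmx P /\ X.2 = P *m Y.2 *m invmx P.

Definition mx3 (K : fieldType) (rows : seq (seq K)) : 'M[K]_3 :=
  \matrix_(i, j) (nth [::] rows i)`_j.

Section Forms.
Variables (K : fieldType).

Definition cond1 (l1 l2 l3 : K) : Prop :=
  [/\ [/\ l1 != 0, l2 != 0 & l3 != 0],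
      [/\ l1 != l2, l1 != l3 & l2 != l3],
      l1 = - (l3 ^+ 2 / l2) &
      l1 ^+ 2 - l1 * l2 + l2 ^+ 2 != 0].

Definition form1 (l1 l2 l3 : K) : 'M[K]_3 * 'M[K]_3 :=
  (mx3 [:: [:: l1; 0;  0 ];
           [:: 0;  l2; 0 ];
           [:: 0;  0;  l3]],
   mx3 [:: [:: l2 ^+ 3 / (l2 ^+ 2 + l3 ^+ 2); 1; 1];
           [:: l3 ^+ 2 * (l2 ^+ 4 + l2 ^+ 2 * l3 ^+ 2 + l3 ^+ 4)
                 / (l2 ^+ 2 + l3 ^+ 2) ^+ 2;
               - (l3 ^+ 4 / (l2 * (l2 ^+ 2 + l3 ^+ 2)));
               - (l3 ^+ 3 * (l2 ^+ 2 + l2 * l3 + l3 ^+ 2)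
                    / (l2 ^+ 2 * (l2 ^+ 2 + l3 ^+ 2)))];
           [:: 0; 0; l3]]).

Definition form1' (l1 l2 l3 : K) : 'M[K]_3 * 'M[K]_3 :=
  (mx3 [:: [:: l2; l2; 0 ];
           [:: 0;  l1; 0 ];
           [:: 0;  0;  l3]],
   mx3 [:: [:: l1; 0;
               (l3 ^+ 2 - (l1 - l2) * l3 + l2 ^+ 2) / (l2 ^+ 2 + l3 ^+ 2)];
           [:: - l1; l2; -1];
           [:: 0; 0; l3]]).

Definition cond2 (l1 l2 : K) : Prop :=
  [/\ l1 != 0 /\ l2 != 0, l1 != l2 &
      exists2 z : K, 4.-primitive_root z & l1 = l2 * z].

Definition form2 (l1 l2 : K) : 'M[K]_3 * 'M[K]_3 :=
  (mx3 [:: [:: l1; 1;  0 ];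
           [:: 0;  l1; 0 ];
           [:: 0;  0;  l2]],
   mx3 [:: [:: 2 * l1;  1; (2 * l1 + l2) / l2 ^+ 2];
           [:: l2 ^+ 2; 0; 1];
           [:: 0;       0; l2]]).

Definition form2' (l1 l2 : K) : 'M[K]_3 * 'M[K]_3 :=
  (mx3 [:: [:: l1; l1; 0 ];
           [:: 0;  l1; 0 ];
           [:: 0;  0;  l2]],
   mx3 [:: [:: l1;   0;  1 + l1 / l2];
           [:: - l1; l1; l2 / l1];
           [:: 0;    0;  l2]]).

Definition cond3 (l1 l2 : K) : Prop :=
  [/\ l1 != 0 /\ l2 != 0, l1 != l2 & l1 = - l2].

Definition form3 (l1 l2 : K) : 'M[K]_3 * 'M[K]_3 :=
  (mx3 [:: [:: l1; 0;  0 ];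
           [:: 0;  l2; 1 ];
           [:: 0;  0;  l2]],
   mx3 [:: [:: l2 / 2;            1;          0 ];
           [:: 3 * l2 ^+ 2 / 4;   - (l2 / 2); -2];
           [:: 0;                 0;          l2]]).

Definition form3' (l1 l2 : K) : 'M[K]_3 * 'M[K]_3 :=
  (mx3 [:: [:: l1; l1; 1 ];
           [:: 0;  l2; -2];
           [:: 0;  0;  l2]],
   mx3 [:: [:: l2;   0;  -2];
           [:: - l2; l1; 4 ];
           [:: 0;    0;  l2]]).

End Forms.

(* Main.v *)
Require Import Defs.
From mathcomp Require Import all_boot all_order all_algebra.
From mathcomp Require Import ring.
Import GRing.Theory.
Local Open Scope ring_scope.

(** A line is an invariant subspace exactly when it is spanned by a common
eigenvector of [rho sigma1] and [rho sigma2].  Since the minimal dimension of a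
non-zero invariant subspace is two, there is no such vector in [V]; this rules
out, inside the invariant plane [W], the reducible action on [W], and outside
[W], the splitting of [V] as [W] plus a line.  The classification is therefore
that of the pairs of block triangular matrices
[[A0, u], [0, r]], [[B0, u'], [0, r]] that satisfy the braid relation and have
no common eigenvector (the scalars on the quotient line [V/W] agree by the
braid relation).

On [W], let [v1] be an eigenvector of [A] with eigenvalue [p], and let [q] be
the other eigenvalue of [A].  Then [v2 := A B v1] satisfies [B v2 = p v2],
because [B A B = A B A], and it is not a multiple of [v1].  In the basis
[v1, v2], suitably scaled, the braid relation forces
[A0 = [[p, p], [0, q]]] and [B0 = [[q, 0], [-q, p]]]
([admissible_normal_form]).  Moreover [p^2 - p q + q^2 <> 0]
([plane_irreducible]).

It remains to choose the third basis vector [v3], which can be shifted by an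
element of [W] and scaled.
- If [p] and [q] differ from [r], a shift makes [v3] an eigenvector of [A]; the
  braid relation is then a homogeneous 2 x 2 linear system for the last column
  of [B], with determinant [(r - q) (r - p) (p q + r^2)].  Its solution is
  non-zero, so [p q = - r^2], and it is unique up to scale
  ([generic_form]).  This gives the first family if [p <> q] and the second one
  if [p = q].
- If [p] or [q] equals [r], a shift kills one entry in the last column of [A]
  and one in that of [B].  The braid relation then gives that the other
  eigenvalue on [W] is [- r] and relates the two remaining entries by a fixed
  factor ([repeated_form3'], [repeated_form3]); this is the third family.

The characteristic matters only through the invertibility of 2 and 3.  The
equivalence of the alternative forms is witnessed by explicit changes of
basis. *)

Set Implicit Arguments.
Unset Strict Implicit.
Unset Printing Implicit Defensive.

(** * Simultaneous conjugation of pairs of matrices *)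

Section Equivalence.
Variables (K : fieldType) (n : nat).
Implicit Types X Y Z : 'M[K]_n * 'M[K]_n.

Lemma equivalent_pairsI X Y (P : 'M[K]_n) :
  P \in unitmx -> X.1 *m P = P *m Y.1 -> X.2 *m P = P *m Y.2 ->
  equivalent_pairs X Y.
Proof. by move=> uP e1 e2; exists P; rewrite // -?e1 -?e2 !mulmxK. Qed.

Lemma equivalent_pairsE X Y : equivalent_pairs X Y ->
  exists2 P : 'M[K]_n, P \in unitmx &
    X.1 *m P = P *m Y.1 /\ X.2 *m P = P *m Y.2.
Proof. by case=> P uP [-> ->]; exists P; rewrite ?mulmxKV. Qed.

Lemma equivalent_pairs_refl X : equivalent_pairs X X.
Proof. by apply: (equivalent_pairsI (unitmx1 K n)); rewrite mul1mx mulmx1. Qed.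

Lemma equivalent_pairs_sym X Y : equivalent_pairs X Y -> equivalent_pairs Y X.
Proof.
case/equivalent_pairsE=> P uP [e1 e2].
have uQ : invmx P \in unitmx by rewrite unitmx_inv.
apply: (equivalent_pairsI uQ).
- by rewrite -[LHS](mulKmx uP) [P *m _]mulmxA -e1 mulmxK.
- by rewrite -[LHS](mulKmx uP) [P *m _]mulmxA -e2 mulmxK.
Qed.

Lemma equivalent_pairs_trans Y X Z :
  equivalent_pairs X Y -> equivalent_pairs Y Z -> equivalent_pairs X Z.
Proof.
case/equivalent_pairsE=> P uP [e1 e2].
case/equivalent_pairsE=> Q uQ [e3 e4].
apply: (@equivalent_pairsI _ _ (P *m Q)); first by rewrite unitmx_mul uP.
- by rewrite mulmxA e1 -mulmxA e3 mulmxA.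
- by rewrite mulmxA e2 -mulmxA e4 mulmxA.
Qed.

(** The pairs of matrices of those representations of the braid group that have
no one-dimensional invariant subspace, i.e., no common eigenvector. *)
Definition admissible X : Prop :=
  [/\ X.1 \in unitmx, X.2 \in unitmx,
      X.1 *m X.2 *m X.1 = X.2 *m X.1 *m X.2 &
      forall (v : 'cV[K]_n) s t,
        X.1 *m v = s *: v -> X.2 *m v = t *: v -> v = 0].

Lemma admissible_equiv X Y :
  equivalent_pairs X Y -> admissible X -> admissible Y.
Proof.
case/equivalent_pairs_sym=> P uP [eY1 eY2] [u1 u2 br nev]; split.
- by rewrite eY1 !unitmx_mul uP u1 unitmx_inv.
- by rewrite eY2 !unitmx_mul uP u2 unitmx_inv.
- by rewrite eY1 eY2 !mulmxA !mulmxKV // -!mulmxA !(mulmxA X.1, mulmxA X.2)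
    !(mulmxA (X.1 *m X.2), mulmxA (X.2 *m X.1)) br.
- move=> v s t; rewrite eY1 eY2 => e1 e2.
  rewrite -[v](mulKVmx uP) (nev (invmx P *m v) s t) ?mulmx0 //.
  + by rewrite scalemxAr -e1 -!mulmxA mulKmx.
  + by rewrite scalemxAr -e2 -!mulmxA mulKmx.
Qed.

End Equivalence.

(** * Block triangular matrices of size three *)

(** An equation follows from others, up to a non-zero factor [x], once it is
exhibited as a linear combination of them; the side condition is a polynomial
identity. *)
Lemma lincomb1 (K : fieldType) (x k l r a b : K) :
  x != 0 -> l = r -> x * (a - b) = k * (l - r) -> a = b.
Proof.
move=> x0 -> /eqP; rewrite subrr mulr0 mulf_eq0 (negPf x0) subr_eq0.
by move/eqP.
Qed.

Lemma lincomb2 (K : fieldType) (x k l r k' l' r' a b : K) :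
  x != 0 -> l = r -> l' = r' ->
  x * (a - b) = k * (l - r) + k' * (l' - r') -> a = b.
Proof.
move=> x0 -> -> e; apply: (lincomb1 (k := 0) x0 (erefl 0)).
by rewrite e !subrr !mulr0 addr0.
Qed.

Section Blocks.
Variable K : fieldType.
Implicit Types a b c d u v r p q x y z w s t k : K.

(** The matrix [[a, b, u], [c, d, v], [0, 0, r]], which preserves the plane
spanned by the first two basis vectors. *)
Definition blk a b c d u v r : 'M[K]_3 :=
  mx3 [:: [:: a; b; u]; [:: c; d; v]; [:: 0; 0; r]].

Lemma blk_mul a b c d u v r a' b' c' d' u' v' r' :
  blk a b c d u v r *m blk a' b' c' d' u' v' r' =
  blk (a * a' + b * c') (a * b' + b * d') (c * a' + d * c') (c * b' + d * d')
      (a * u' + b * v' + u * r') (c * u' + d * v' + v * r') (r * r').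
Proof.
apply/matrixP=> -[[|[|[|i]]] hi] // [[|[|[|j]]] hj] //;
  by rewrite !mxE !big_ord_recr big_ord0 /= !mxE /=; ring.
Qed.

Lemma blk_inj a b c d u v r a' b' c' d' u' v' r' :
  blk a b c d u v r = blk a' b' c' d' u' v' r' ->
  [/\ [/\ a = a', b = b', c = c' & d = d'], u = u', v = v' & r = r'].
Proof.
move/matrixP=> e.
have E (i j : nat) (hi : (i < 3)%N) (hj : (j < 3)%N) :=
  e (Ordinal hi) (Ordinal hj).
have:= (E 0 0 isT isT, E 0 1 isT isT, E 0 2 isT isT,
  E 1 0 isT isT, E 1 1 isT isT, E 1 2 isT isT, E 2 2 isT isT)%N.
by rewrite !mxE /= => -[[[[[[-> ->] ->] ->] ->] ->] ->].
Qed.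

Lemma det_blk a b c d u v r : \det (blk a b c d u v r) = (a * d - b * c) * r.
Proof.
rewrite (expand_det_row _ ord_max) !big_ord_recr big_ord0 /= !mxE /=.
rewrite !mul0r !add0r /cofactor (expand_det_row _ ord0).
rewrite !big_ord_recr big_ord0 /= /cofactor !det_mx11 !mxE /=; ring.
Qed.

Lemma blk_unitE a b c d u v r :
  (blk a b c d u v r \in unitmx) = ((a * d - b * c) * r != 0).
Proof. by rewrite unitmxE det_blk unitfE. Qed.

Lemma blk_equiv a b c d u v r a1 b1 c1 d1 u1 v1 r1 a2 b2 c2 d2 u2 v2 r2 Y1 Y2 :
  (a * d - b * c) * r != 0 ->
  blk a1 b1 c1 d1 u1 v1 r1 *m blk a b c d u v r = blk a b c d u v r *m Y1 ->
  blk a2 b2 c2 d2 u2 v2 r2 *m blk a b c d u v r = blk a b c d u v r *m Y2 ->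
  equivalent_pairs
    (blk a1 b1 c1 d1 u1 v1 r1, blk a2 b2 c2 d2 u2 v2 r2) (Y1, Y2).
Proof.
rewrite -(blk_unitE _ _ _ _ u v) => uP e1 e2.
exact: (equivalent_pairsI uP).
Qed.

Lemma admissible_blk_vec a1 b1 c1 d1 u1 v1 r1 a2 b2 c2 d2 u2 v2 r2 x y z s t :
  admissible (blk a1 b1 c1 d1 u1 v1 r1, blk a2 b2 c2 d2 u2 v2 r2) ->
  a1 * x + b1 * y + u1 * z = s * x -> c1 * x + d1 * y + v1 * z = s * y ->
  r1 * z = s * z ->
  a2 * x + b2 * y + u2 * z = t * x -> c2 * x + d2 * y + v2 * z = t * y ->
  r2 * z = t * z ->
  [/\ x = 0, y = 0 & z = 0].
Proof.
case=> _ _ _ nev e11 e12 e13 e21 e22 e23.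
pose w : 'cV[K]_3 := \col_i [:: x; y; z]`_i.
suff /colP w0 : w = 0.
  have := (w0 0, w0 1, w0 (inord 2)).
  by rewrite !mxE inordK // => -[[/= -> ->] ->].
apply: (nev _ s t); apply/colP=> -[[|[|[|i]]] hi] //;
  rewrite !mxE !big_ord_recr big_ord0 /= !mxE /= ?add0r ?mul0r ?add0r //.
Qed.

End Blocks.

Arguments blk_equiv {K} a b c d u v r
  {a1 b1 c1 d1 u1 v1 r1 a2 b2 c2 d2 u2 v2 r2 Y1 Y2}.

(** * Normal form on the invariant plane *)

(** The action on the plane is in normal form, with eigenvalues [p] and [q], the
quotient line has eigenvalue [r], and [a, b], [c, d] are the free entries. *)
Local Notation normal_pair p q r a b c d :=
  (blk p p 0 q a b r, blk q 0 (- q) p c d r).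

Section Triangular.
Variable K : closedFieldType.
Implicit Types a b c d u v r p q x y z w s t : K.

Lemma quadratic_root s t : exists p, p ^+ 2 = s * p - t.
Proof.
have [p pE] := @solve_monicpoly K 2 (nth 0 [:: - t; s]) isT.
by exists p; rewrite pE !big_ord_recr big_ord0 /=; ring.
Qed.

Lemma blk_triangular a b c d u v r a2 b2 c2 d2 u2 v2 r2 :
  exists p x q u' v' Y,
    [/\ equivalent_pairs
          (blk a b c d u v r, blk a2 b2 c2 d2 u2 v2 r2)
          (blk p x 0 q u' v' r, Y) &
        exists y z w t c' d', Y = blk y z w t c' d' r2].
Proof.
have [c0|c0] := eqVneq c 0.
  rewrite c0; do 6!eexists.
  by split; [apply: equivalent_pairs_refl | do 6!eexists].
(* The new basis starts with the eigenvector (p - d, c) of the plane block. *)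
have [p pE] := quadratic_root (a + d) (a * d - b * c).
pose inv_l x y := y / c; pose inv_r x y := x - (p - d) * (y / c).
pose y1 := a2 * (p - d) + b2 * c; pose y2 := c2 * (p - d) + d2 * c.
exists p, 1, (a + d - p), (inv_l u v), (inv_r u v),
  (blk (inv_l y1 y2) (inv_l a2 c2) (inv_r y1 y2) (inv_r a2 c2)
      (inv_l u2 v2) (inv_r u2 v2) r2).
split; last by do 6!eexists.
apply: (blk_equiv (p - d) 1 c 0 0 0 1).
- by rewrite mulr0 sub0r mul1r mulr1 oppr_eq0.
- rewrite !blk_mul /inv_l /inv_r; congr blk; try by field.
  by ring: pE.
- by rewrite !blk_mul /inv_l /inv_r /y1 /y2; congr blk; field.
Qed.

End Triangular.

Section NormalPairs.
Variable K : fieldType.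
Implicit Types a b c d u v r p q x y z w s t k : K.

(** The entry [z] does not vanish since the first basis vector is not a common
eigenvector. *)
Lemma admissible_triangular_neq0 p x q u v r y w z t c d r' :
  admissible (blk p x 0 q u v r, blk y w z t c d r') ->
  [/\ p != 0, q != 0, r != 0, z != 0 & r' = r].
Proof.
move=> ad; have [uA uB br _] := ad.
rewrite blk_unitE mulr0 subr0 !mulf_eq0 !negb_or in uA.
rewrite blk_unitE !mulf_eq0 !negb_or in uB.
case/andP: uA uB => /andP[p0 q0] r0 /andP[_ s0]; split=> //.
  apply: contraNneq p0 => z0.
  by case: (admissible_blk_vec (x := 1) (y := 0) (z := 0) (s := p) (t := y) ad);
    rewrite ?z0; try ring; move/eqP; rewrite oner_eq0.
move: br; rewrite !blk_mul => /blk_inj[_ _ _ e].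
by apply: (lincomb1 (x := r * r') (k := -1) _ e); [rewrite mulf_neq0 | ring].
Qed.

(** The second basis vector can be taken proportional to the image under [A B]
of the first one; it is then an eigenvector of [B] with eigenvalue [p]. *)
Lemma admissible_shear p x q a b r y u z w c d :
  admissible (blk p x 0 q a b r, blk y u z w c d r) ->
  exists x' a' b' y' c' d',
    equivalent_pairs (blk p x 0 q a b r, blk y u z w c d r)
      (blk p x' 0 q a' b' r, blk y' 0 z p c' d' r).
Proof.
move=> ad; have [p0 q0 r0 z0 _] := admissible_triangular_neq0 ad.
have [_ _ br _] := ad.
move: br; rewrite !blk_mul => /blk_inj[[e00 _ e10 _] _ _ _].
(* A B maps (1, 0) to (p y + x z, q z), which is proportional to (s, 1). *)
pose s := (p * y + x * z) / (q * z).
have sE : q * z * s = p * y + x * z by rewrite /s; field; rewrite z0.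
have qz0 : q * z != 0 by rewrite mulf_neq0.
exists (x + s * p - s * q), (a - s * b), b, (y - s * z), (c - s * d), d.
apply: (blk_equiv 1 s 0 1 0 0 1).
- by rewrite mulr0 subr0 !mulr1 oner_eq0.
- by rewrite !blk_mul; congr blk; ring.
- rewrite !blk_mul; congr blk; try by ring.
  + by apply: (lincomb2 (k := -1) (k' := y - p) qz0 e00 sE); ring.
  + by apply: (lincomb2 (k := -1) (k' := z) qz0 e10 sE); ring.
Qed.

Lemma admissible_scale p x q a b r y z c d :
  admissible (blk p x 0 q a b r, blk y 0 z p c d r) ->
  exists a' b' c' d',
    equivalent_pairs (blk p x 0 q a b r, blk y 0 z p c d r)
      (normal_pair p q r a' b' c' d').
Proof.
move=> ad; have [p0 q0 r0 z0 _] := admissible_triangular_neq0 ad.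
have [_ uB br _] := ad.
move: br; rewrite !blk_mul => /blk_inj[[_ e01 e10 _] _ _ _].
rewrite blk_unitE mul0r subr0 !mulf_eq0 !negb_or in uB.
case/andP: uB => /andP[y0 _] _.
have zx : z * x = - (p * y) by apply: (lincomb1 (k := -1) z0 e10); ring.
have x0 : x != 0.
  apply: contraNneq y0 => x0; move/eqP: zx.
  by rewrite x0 mulr0 eq_sym oppr_eq0 mulf_eq0 (negPf p0).
have yq : y = q.
  by apply: (lincomb2 (x := x * p) (k := -1) (k' := x) _ e01 zx);
    rewrite ?mulf_neq0 //; ring.
exists (a * p / x), b, (c * p / x), d.
apply: (blk_equiv (x / p) 0 0 1 0 0 1).
- by rewrite mulr0 subr0 !mulr1 mulf_neq0 ?invr_neq0.
- by rewrite !blk_mul; congr blk; field; rewrite ?x0 ?p0.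
- rewrite !blk_mul yq; congr blk; try by field; rewrite ?x0 ?p0.
  apply: (lincomb1 (k := 1) p0 zx); rewrite yq; field; exact: p0.
Qed.

(** Effect of adding [s] times the first and [t] times the second basis vector
to the third one. *)
Lemma blk_shift p q r a b c d s t :
  equivalent_pairs (normal_pair p q r a b c d)
    (normal_pair p q r
       (a + (p - r) * s + p * t) (b + (q - r) * t)
       (c + (q - r) * s) (d - q * s + (p - r) * t)).
Proof.
apply: (blk_equiv 1 0 0 1 s t 1).
- by rewrite mulr0 subr0 !mulr1 oner_eq0.
- by rewrite !blk_mul; congr blk; ring.
- by rewrite !blk_mul; congr blk; ring.
Qed.

Lemma blk_scale3 p q r a b c d k : k != 0 ->
  equivalent_pairs (normal_pair p q r a b c d)
    (normal_pair p q r (a * k) (b * k) (c * k) (d * k)).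
Proof.
move=> k0; apply: (blk_equiv 1 0 0 1 0 0 k).
- by rewrite mulr0 subr0 !mulr1 mul1r.
- by rewrite !blk_mul; congr blk; ring.
- by rewrite !blk_mul; congr blk; ring.
Qed.

(** For [p^2 - p q + q^2 = 0], the eigenvector [(p, q - p)] of the first plane
block is one of the second block too. *)
Lemma plane_irreducible p q r a b c d :
  admissible (normal_pair p q r a b c d) ->
  p ^+ 2 - p * q + q ^+ 2 != 0.
Proof.
move=> ad; have [p0 _ _ _ _] := admissible_triangular_neq0 ad.
apply: contraNneq p0 => e.
have [||||||->] // := admissible_blk_vec (x := p) (y := q - p) (z := 0)
   (s := q) (t := q) ad; try by ring.
by apply: (lincomb1 (x := 1) (k := -1) _ e); [rewrite oner_eq0 | ring].
Qed.

(** Otherwise the third basis vector is a common eigenvector. *)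
Lemma complement_neq0 p q r a b c d :
  admissible (normal_pair p q r a b c d) ->
  a = 0 -> b = 0 -> c = 0 -> d = 0 -> False.
Proof.
move=> ad a0 b0 c0 d0.
have [||||||_ _ /eqP] := admissible_blk_vec (x := 0) (y := 0) (z := 1)
   (s := r) (t := r) ad; rewrite ?a0 ?b0 ?c0 ?d0; try by ring.
by rewrite oner_eq0.
Qed.

End NormalPairs.

Lemma admissible_normal_form (K : closedFieldType)
    (a b c d u v r a2 b2 c2 d2 u2 v2 r2 : K) :
  admissible (blk a b c d u v r, blk a2 b2 c2 d2 u2 v2 r2) ->
  exists p q a' b' c' d',
    equivalent_pairs (blk a b c d u v r, blk a2 b2 c2 d2 u2 v2 r2)
      (normal_pair p q r a' b' c' d').
Proof.
move=> ad0.
have [p [x [q [u' [v' [Y [e1 [y [z [w [t [c' [d' YE]]]]]]]]]]]]] :=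
  blk_triangular a b c d u v r a2 b2 c2 d2 u2 v2 r2.
move: e1; rewrite {}YE => e1; have ad1 := admissible_equiv e1 ad0.
have [_ _ _ _ r2E] := admissible_triangular_neq0 ad1.
rewrite {}r2E in e1 ad0 ad1 *.
have [x' [a' [b' [y' [c'' [d'' e2]]]]]] := admissible_shear ad1.
have ad2 := admissible_equiv e2 ad1.
have [a3 [b3 [c3 [d3 e3]]]] := admissible_scale ad2.
exists p, q, a3, b3, c3, d3.
exact: equivalent_pairs_trans e1 (equivalent_pairs_trans e2 e3).
Qed.

(** * The last column *)

Section LastColumn.
Variable K : fieldType.
Implicit Types a b c d r p q s t k : K.

(** If [r] is not an eigenvalue on the plane, the last column is unique up to a
non-zero factor [k]. *)
Lemma generic_form p q r a b c d : p != r -> q != r ->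
  admissible (normal_pair p q r a b c d) ->
  p * q = - r ^+ 2 /\
  forall k, k != 0 ->
    equivalent_pairs (normal_pair p q r a b c d)
     (normal_pair p q r 0 0 ((q - r) / r * k) k).
Proof.
rewrite -[p == r]subr_eq0 -[q == r]subr_eq0 => pr0 qr0 ad0.
pose t := - b / (q - r); pose s := - (a + p * t) / (p - r).
have := blk_shift p q r a b c d s t.
have -> : a + (p - r) * s + p * t = 0 by rewrite /s; field.
have -> : b + (q - r) * t = 0 by rewrite /t; field.
move: (c + _) (d - _ + _) => {s t} c1 d1 e1; have ad := admissible_equiv e1 ad0.
have [p0 q0 r0 _ _] := admissible_triangular_neq0 ad.
have [_ _ br _] := ad; move: br; rewrite !blk_mul => /blk_inj[_ E1 E2 _].
(* E1 and E2 form a homogeneous linear system in c1 and d1, with determinant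
   (r - q) (r - p) (p q + r ^+ 2). *)
have pq : p * q = - r ^+ 2.
  apply/eqP/negPn/negP; rewrite -subr_eq0 opprK => D0.
  have D1 : (r - q) * (r - p) * (p * q + r ^+ 2) != 0.
    by rewrite !mulf_neq0 // -opprB oppr_eq0.
  apply: (complement_neq0 ad) => //.
  - apply: (lincomb2 (k := - (r ^+ 2 - r * q)) (k' := p * (q - r)) D1 E1 E2).
    by ring.
  - apply: (lincomb2 (k := - (p * q)) (k' := - (p * q - r * p + r ^+ 2))
      D1 E1 E2).
    by ring.
have cE : c1 = (q - r) / r * d1.
  apply: (lincomb2 (x := r ^+ 2) (k := -1) (k' := c1) _ E2 pq).
    by rewrite expf_neq0.
  by field.
have d0 : d1 != 0.
  by apply/eqP => d0; apply: (complement_neq0 ad) => //; rewrite cE d0 mulr0.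
split=> // k k0; apply: equivalent_pairs_trans e1 _.
have /(blk_scale3 p q r 0 0 c1 d1) : k / d1 != 0.
  by rewrite mulf_neq0 ?invr_neq0.
have dk : d1 * (k / d1) = k by rewrite mulrC divfK.
by rewrite !mul0r cE -[_ * d1 * (k / d1)]mulrA dk.
Qed.

(** The case where the eigenvalue [q] on the plane is [r]. *)
Lemma repeated_form3' p r a b c d : 2 != 0 :> K -> 3 != 0 :> K ->
  admissible (normal_pair p r r a b c d) ->
  p = - r /\
  equivalent_pairs (normal_pair p r r a b c d) (form3' (- r) r).
Proof.
move=> two0 three0 ad0; have D0 := plane_irreducible ad0.
pose D := p ^+ 2 - p * r + r ^+ 2; have D0' : D != 0 by [].
pose s := (p * d - a * (p - r)) / D; pose t := - ((p - r) * d + r * a) / D.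
have := blk_shift p r r a b c d s t.
have -> : a + (p - r) * s + p * t = 0 by rewrite /s /t /D; field.
have -> : d - r * s + (p - r) * t = 0 by rewrite /s /t /D; field.
rewrite subrr !mul0r !addr0 => e1; have ad := admissible_equiv e1 ad0.
have [p0 _ r0 _ _] := admissible_triangular_neq0 ad.
have [_ _ br _] := ad; move: br; rewrite !blk_mul => /blk_inj[_ E1 E2 _].
have rb : r * b = - (c * p) by apply: (lincomb1 (k := 1) r0 E2); ring.
have c0 : c != 0.
  apply/eqP=> c0; apply: (complement_neq0 ad) => //.
  by apply: (lincomb1 (k := 1) r0 rb); rewrite c0; ring.
(* c * (p + r) * D = c * (p ^+ 3 + r ^+ 3) vanishes. *)
have pr : p = - r.
  apply: (lincomb2 (x := c * D) (k := - r) (k' := p ^+ 2) _ E1 rb).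
    by rewrite mulf_neq0.
  by rewrite /D; ring.
have bc : b = c by apply: (lincomb1 (k := 1) r0 rb); rewrite pr; ring.
split=> //; apply: equivalent_pairs_trans e1 _; rewrite {}bc {}pr.
(* Third basis vector: scaled to give the entries -2, then shifted. *)
have k0 : - 2 / c != 0 by rewrite mulf_neq0 ?invr_neq0 ?oppr_eq0.
apply: equivalent_pairs_trans (blk_scale3 _ _ _ _ _ _ _ k0) _.
have := blk_shift (- r) r r 0 (- 2) (- 2) 0 (2 / (3 * r)) (- 7 / (3 * r)).
have -> : 0 + (- r - r) * (2 / (3 * r)) + - r * (- 7 / (3 * r)) = 1.
  by field; rewrite r0.
have -> : 0 - r * (2 / (3 * r)) + (- r - r) * (- 7 / (3 * r)) = 4.
  by field; rewrite r0.
rewrite subrr !mul0r !addr0 mulrC divfK // => h; exact: h.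
Qed.

(** The case where the eigenvalue [p] on the plane is [r]. *)
Lemma repeated_form3 q r a b c d : 2 != 0 :> K -> q != r ->
  admissible (normal_pair r q r a b c d) ->
  q = - r /\
  equivalent_pairs (normal_pair r q r a b c d) (form3 (- r) r).
Proof.
rewrite -[q == r]subr_eq0 => two0 qr0 ad0.
have four0 : 4 != 0 :> K by rewrite (natrM _ 2 2) mulf_neq0.
have := blk_shift r q r a b c d (- c / (q - r)) (- b / (q - r)).
have -> : b + (q - r) * (- b / (q - r)) = 0 by field.
have -> : c + (q - r) * (- c / (q - r)) = 0 by field.
move: (a + _ + _) (d - _ + _) => a1 d1 e1; have ad := admissible_equiv e1 ad0.
have [r0 q0 _ _ _] := admissible_triangular_neq0 ad.
have rq0 : r - q != 0 by rewrite -opprB oppr_eq0.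
have [_ _ br _] := ad; move: br; rewrite !blk_mul => /blk_inj[_ E1 E2 _].
have da : d1 = - a1.
  apply: (lincomb1 (x := r * (r - q)) (k := 1) _ E1); last by ring.
  by rewrite mulf_neq0.
have a0 : a1 != 0.
  by apply/eqP=> a0; apply: (complement_neq0 ad) => //; rewrite da a0 oppr0.
have qr : q = - r.
  apply: (lincomb2 (x := a1 * (r - q)) (k := 1) (k' := r ^+ 2 - q * r) _ E2 da).
    by rewrite mulf_neq0.
  by ring.
split=> //; apply: equivalent_pairs_trans e1 _; rewrite {}da {}qr.
(* The first two columns of the change of basis are eigenvectors of A for the
   eigenvalues - r and r. *)
apply: (blk_equiv
  1 (- 2 / r) (- 2) 0 (- 2 / r ^+ 2) 0 (- 2 / (a1 * r))).
- by rewrite mulr0 sub0r !mulf_neq0 ?oppr_eq0 ?mulf_neq0 ?invr_neq0 ?oppr_eq0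
    ?mulf_neq0.
- by rewrite [mx3 _]/(blk _ _ _ _ _ _ _) !blk_mul; congr blk; field;
    rewrite ?r0 ?a0.
- by rewrite [mx3 _]/(blk _ _ _ _ _ _ _) !blk_mul; congr blk; field;
    rewrite ?r0 ?a0 ?two0 ?four0.
Qed.

End LastColumn.

(** * Comparison with the listed forms *)

Section Forms.
Variable K : fieldType.
Implicit Types a b c d r p q : K.

Lemma form1_form1' (l1 l2 l3 : K) : cond1 l1 l2 l3 ->
  equivalent_pairs (form1 l1 l2 l3) (form1' l1 l2 l3).
Proof.
case=> [[l10 l20 l30] [l12 _ _] l1E _].
have N0 : l2 ^+ 2 + l3 ^+ 2 != 0.
  apply: contra l12; rewrite l1E addrC addr_eq0 => /eqP ->.
  by rewrite mulNr opprK expr2 mulfK.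
rewrite l1E.
(* The first and the third column of the change of basis are eigenvectors of A;
   B fixes their ratio and the second column. *)
apply: (blk_equiv
  0 (l2 / l3 ^+ 2) 1 (l2 ^+ 2 / (l2 ^+ 2 + l3 ^+ 2)) 0 0 (- l2 / l3 ^+ 2)).
- by rewrite mul0r sub0r mulr1 mulf_neq0 ?oppr_eq0 ?mulf_neq0 ?invr_neq0
    ?oppr_eq0 ?expf_neq0.
- by rewrite [mx3 _]/(blk _ _ _ _ _ _ _) !blk_mul; congr blk; field;
    rewrite ?l20 ?l30 ?N0.
- by rewrite [mx3 _]/(blk _ _ _ _ _ _ _) !blk_mul; congr blk; field;
    rewrite ?l20 ?l30 ?N0.
Qed.

Lemma prim4_sqr (z : K) : 4.-primitive_root z -> z ^+ 2 = -1.
Proof.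
move=> zP; apply/eqP; rewrite -subr_eq0 opprK.
have z2 : z ^+ 2 - 1 != 0.
  by rewrite subr_eq0 -[1](expr0 z) (eq_prim_root_expr zP).
suff : (z ^+ 2 - 1) * (z ^+ 2 + 1) == 0 by rewrite mulf_eq0 (negPf z2).
have z4 := prim_expr_order zP; apply/eqP.
transitivity (z ^+ 4 - 1); first by ring.
by rewrite z4 subrr.
Qed.

Lemma sqr_prim4 (z : K) : 2 != 0 :> K -> z ^+ 2 = -1 -> 4.-primitive_root z.
Proof.
move=> two0 zE.
have N1 : -1 != 1 :> K by rewrite -subr_eq0 -opprD oppr_eq0.
have z1 : z != 1 by apply: contraNneq N1 => z1; rewrite -zE z1 expr1n.
have z3 : z ^+ 3 != 1.
  apply: contraNneq N1 => z3; rewrite exprS zE mulrN1 in z3.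
  by rewrite -zE -[z]opprK z3 sqrrN expr1n.
apply/andP; split=> //; apply/forallP=> -[[|[|[|[|i]]]] hi] //;
  rewrite unity_rootE /= ?expr1 ?(negPf z1) ?(negPf z3) ?zE ?(negPf N1) //.
by rewrite -[4%N]/(2 * 2)%N exprM zE sqrrN expr1n !eqxx.
Qed.

Lemma form2_form2' (l1 l2 : K) : cond2 l1 l2 ->
  equivalent_pairs (form2 l1 l2) (form2' l1 l2).
Proof.
case=> [[l10 l20] _ [z /prim4_sqr zE l1E]].
have l1q : l1 ^+ 2 = - l2 ^+ 2 by rewrite l1E exprMn zE mulrN1.
(* As for the first form, A gives the first and the third column up to
   factors, and B gives the rest. *)
apply: (blk_equiv 1 (- 1) 0 l1 0 0 l2).
- by rewrite mulr0 subr0 mul1r mulf_neq0.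
- by rewrite [mx3 _]/(blk _ _ _ _ _ _ _) !blk_mul; congr blk; ring: l1q.
- by rewrite [mx3 _]/(blk _ _ _ _ _ _ _) !blk_mul; congr blk; field: l1q;
    rewrite ?l10 ?l20.
Qed.

Lemma form3_form3' (l1 l2 : K) : 2 != 0 :> K -> 3 != 0 :> K -> cond3 l1 l2 ->
  equivalent_pairs (form3 l1 l2) (form3' l1 l2).
Proof.
move=> two0 three0 [[_ l20] _ ->].
have four0 : 4 != 0 :> K by rewrite (natrM _ 2 2) mulf_neq0.
(* The first column is an eigenvector of A, B then gives the second one, and the
   third one solves the remaining linear equations. *)
apply: (blk_equiv
  1 (1 / 2) 0 (- (3 * l2 / 4)) 0 0 (3 * l2 / 2)).
- by rewrite mulr0 subr0 mul1r !mulf_neq0 ?oppr_eq0 ?mulf_neq0 ?invr_neq0.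
- by rewrite [mx3 _]/(blk _ _ _ _ _ _ _) !blk_mul; congr blk; field;
    rewrite ?two0 ?four0 ?l20.
- by rewrite [mx3 _]/(blk _ _ _ _ _ _ _) !blk_mul; congr blk; field;
    rewrite ?two0 ?four0 ?l20.
Qed.

Lemma classification p q r a b c d : 2 != 0 :> K -> 3 != 0 :> K ->
  let X := normal_pair p q r a b c d in
  admissible X ->
  [\/ exists l1 l2 l3 : K,
        cond1 l1 l2 l3 /\ equivalent_pairs X (form1 l1 l2 l3),
      exists l1 l2 : K, cond2 l1 l2 /\ equivalent_pairs X (form2 l1 l2)
    | exists l1 l2 : K, cond3 l1 l2 /\ equivalent_pairs X (form3 l1 l2)].
Proof.
move=> two0 three0 X ad.
have [p0 q0 r0 _ _] := admissible_triangular_neq0 ad.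
have c3 : cond3 (- r) r.
  split=> //; rewrite ?oppr_eq0 //.
  by rewrite eq_sym -subr_eq0 opprK -mulr2n -mulr_natr mulf_neq0.
have [pr|pr] := eqVneq p r.
  subst p; have [qr|qr] := eqVneq q r.
    (* Both eigenvalues equal to r would give r = - r. *)
    subst q; have [rE _] := repeated_form3' two0 three0 ad.
    by case: c3 => _ /negP[]; rewrite eq_sym; apply/eqP.
  have [qE e] := repeated_form3 two0 qr ad.
  by constructor 3; exists (- r), r.
have [qr|qr] := eqVneq q r.
  subst q; have [pE e] := repeated_form3' two0 three0 ad.
  constructor 3; exists (- r), r; split=> //; apply: equivalent_pairs_trans e _.
  by apply/equivalent_pairs_sym/form3_form3'.
have [pq e] := generic_form pr qr ad.
have [qp|qp] := eqVneq q p.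
  subst q; constructor 2; exists p, r.
  have c2 : cond2 p r.
    split=> //; exists (p / r); last by rewrite mulrC divfK.
    apply: sqr_prim4 => //; rewrite expr_div_n expr2 pq mulNr divff //.
    by rewrite expf_neq0.
  split=> //.
  apply: equivalent_pairs_trans (equivalent_pairs_sym (form2_form2' c2)).
  have k0 : r / p != 0 by rewrite mulf_neq0 ?invr_neq0.
  have -> : form2' p r =
      normal_pair p p r 0 0 ((p - r) / r * (r / p)) (r / p).
    congr (_, mx3 [:: [:: _; _; _]; _; _]).
    have p2 : p ^+ 2 = - r ^+ 2 by rewrite expr2.
    by field: p2; rewrite p0 r0.
  exact: e.
constructor 1; exists q, p, r.
have qE : q = - (r ^+ 2 / p) by rewrite -mulNr -pq mulrC mulKf.
have c1 : cond1 q p r.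
  split=> //; have := plane_irreducible ad.
  by have -> // : p ^+ 2 - p * q + q ^+ 2 = q ^+ 2 - q * p + p ^+ 2 by ring.
split=> //.
apply: equivalent_pairs_trans (equivalent_pairs_sym (form1_form1' c1)).
have N0 : p ^+ 2 + r ^+ 2 != 0.
  apply: contra qp => N0; rewrite qE.
  move: N0; rewrite addr_eq0 => /eqP N0.
  by rewrite -mulNr -N0 expr2 mulfK.
have -> : form1' q p r =
    normal_pair p q r 0 0 ((q - r) / r * -1) (-1).
  congr (_, mx3 [:: [:: _; _; _]; _; _]).
  by rewrite qE; field; rewrite p0 r0.
by apply: e; rewrite oppr_eq0 oner_eq0.
Qed.

End Forms.

(** * From representations to matrices *)

Section Representations.
Variables (K : fieldType) (V : vectType K).

Lemma coord_fullv n (e : n.-tuple V) x :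
  basis_of {:V} e -> x = \sum_i coord e i x *: e`_i.
Proof. by move=> he; apply: (coord_basis he); rewrite memvf. Qed.

Lemma end_mx1 n (e : n.-tuple V) : basis_of {:V} e -> end_mx e \1%VF = 1%:M.
Proof.
move=> he; apply/matrixP=> i j.
by rewrite !mxE id_lfunE coord_free ?(basis_free he) // eq_sym.
Qed.

Lemma coord_end n (e : n.-tuple V) (f : 'End(V)) i x : basis_of {:V} e ->
  coord e i (f x) = \sum_j end_mx e f i j * coord e j x.
Proof.
move=> he; rewrite {1}(coord_fullv x he) !linear_sum /=.
by apply: eq_bigr => j _; rewrite !linearZ /= mxE mulrC.
Qed.

Lemma end_mxM n (e : n.-tuple V) (f g : 'End(V)) : basis_of {:V} e ->
  end_mx e (f \o g)%VF = end_mx e f *m end_mx e g.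
Proof.
move=> he; apply/matrixP=> i j; rewrite !mxE comp_lfunE coord_end //.
by apply: eq_bigr => k _; rewrite [end_mx e g _ _]mxE.
Qed.

Lemma end_mx_change n (e b : n.-tuple V) (f g : 'End(V)) :
  basis_of {:V} e -> basis_of {:V} b ->
  equivalent_pairs (end_mx e f, end_mx e g) (end_mx b f, end_mx b g).
Proof.
move=> he hb.
pose P (e b : n.-tuple V) : 'M[K]_n := \matrix_(i, j) coord e i b`_j.
have PQ : P e b *m P b e = 1%:M.
  rewrite -(end_mx1 he); apply/matrixP=> i j; rewrite !mxE id_lfunE.
  rewrite {1}(coord_fullv e`_j hb) linear_sum /=.
  by apply: eq_bigr => k _; rewrite linearZ !mxE mulrC.
have eP h : end_mx e h *m P e b = P e b *m end_mx b h.
  apply/matrixP=> i j; rewrite !mxE.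
  transitivity (coord e i (h b`_j)).
    by rewrite coord_end //; apply: eq_bigr => k _; rewrite [P e b _ _]mxE.
  rewrite {1}(coord_fullv (h b`_j) hb) linear_sum /=.
  by apply: eq_bigr => k _; rewrite linearZ !mxE mulrC.
by case/mulmx1_unit: PQ => uP _; apply: (equivalent_pairsI uP) => /=.
Qed.

Lemma end_mx_admissible (rho : B3 -> 'End(V)) n (e : n.-tuple V) :
  is_representation rho -> basis_of {:V} e ->
  (forall u, Defs.invariant rho <[u]>%VS -> u = 0) ->
  admissible (end_mx e (rho sigma1), end_mx e (rho sigma2)).
Proof.
move=> [rho1 rhoM] he line0.
have inv x : end_mx e (rho x) \in unitmx.
  have : end_mx e (rho x) *m end_mx e (rho x^-1%g) = 1%:M.
    by rewrite -end_mxM // -rhoM mulgV rho1 end_mx1.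
  by case/mulmx1_unit.
split=> //=; first by rewrite -!end_mxM // -!rhoM B3_braid.
move=> v s t es et; pose u := \sum_i v i 0 *: e`_i.
have fe := basis_free he.
have cu i : coord e i u = v i 0 by rewrite coord_sum_free.
have stab x a : end_mx e (rho x) *m v = a *: v ->
    (rho x @: <[u]> <= <[u]>)%VS.
  move=> /colP ea; rewrite limg_line -memvE; apply/vlineP; exists a.
  rewrite [LHS](coord_fullv _ he) scaler_sumr; apply: eq_bigr => i _.
  rewrite scalerA; congr (_ *: _); have := ea i; rewrite [RHS]mxE => <-.
  by rewrite coord_end // mxE; apply: eq_bigr => j _; rewrite cu.
have u0 : u = 0 by apply: line0; split; [exact: stab es | exact: stab et].
by apply/colP=> i; rewrite -cu u0 linear0 mxE.
Qed.

(** A basis of [W] completed to a basis of [V]: every endomorphism that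
preserves [W] is block triangular in it. *)
Lemma invariant_plane_basis (W : {vspace V}) :
  \dim {:V} = 3 -> \dim W = 2 ->
  exists2 b : 3.-tuple V, basis_of {:V} b &
    forall f : 'End(V), (f @: W <= W)%VS ->
    exists a b' c d u v r, end_mx b f = blk a b' c d u v r.
Proof.
move=> dV dW; have := vbasisP W; have := size_tuple (vbasis W).
move: (tval (vbasis W)); rewrite dW.
case=> [|v1 [|v2 [|? ?]]] // _ /andP[/eqP sW frW].
have [v3 v3W] : exists v3, v3 \notin W.
  case: (pickP (fun i : 'I_(\dim {:V}) => (vbasis {:V})`_i \notin W))
      => [i hi|h].
    by exists (vbasis {:V})`_i.
  have : (fullv <= W)%VS.
    rewrite -(span_basis (vbasisP {:V})); apply/span_subvP => x.
    case/(nthP 0) => i; rewrite size_tuple => hi <-.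
    by have := h (Ordinal hi); move/negbFE.
  by move/dimvS; rewrite dV dW.
have fr : free [:: v1; v2; v3].
  have -> : free [:: v1; v2; v3] = free [:: v3; v1; v2].
    by apply: perm_free; rewrite -[[:: v3; v1; v2]]/(rotr 1 [:: v1; v2; v3])
      perm_sym perm_rotr.
  by rewrite free_cons sW v3W.
pose b := [tuple v1; v2; v3].
have hb : basis_of {:V} b by rewrite basisEfree fr subvf dV.
exists b => // f fW.
have c0 x : x \in W -> coord b (inord 2) x = 0.
  rewrite -sW => /(@coord_span _ _ _ [tuple v1; v2]) ->.
  have cb k : (k < 2)%N -> coord b (inord 2) b`_k = 0.
    move=> hk; have k3 : (k < 3)%N by apply: leq_trans hk _.
    have := coord_free (inord k) (inord 2) fr; rewrite inordK // => ->.
    case: eqP => // /(congr1 val); rewrite /= !inordK // => kE.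
    by rewrite kE in hk.
  rewrite !big_ord_recr big_ord0 /= add0r linearD !linearZ /=.
  by have := (cb 0 isT, cb 1 isT)%N => -[/= -> ->]; rewrite !mulr0 addr0.
have memW k : (k < 2)%N -> f b`_k \in W.
  move=> hk; apply: (subvP fW); apply: memv_img; rewrite -sW.
  by case: k hk => [|[|]] // _; apply: memv_span; rewrite !inE eqxx ?orbT.
pose m (i j : nat) := end_mx b f (inord i) (inord j).
exists (m 0 0)%N, (m 0 1)%N, (m 1 0)%N, (m 1 1)%N.
exists (m 0 2)%N, (m 1 2)%N, (m 2 2)%N.
have mE i j hi hj : end_mx b f (@Ordinal 3 i hi) (@Ordinal 3 j hj) = m i j.
  by rewrite /m; congr (end_mx b f _ _); apply: val_inj; rewrite /= inordK.
apply/matrixP=> -[[|[|[|i]]] hi] // [[|[|[|j]]] hj] //;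
  rewrite mE [RHS]mxE //= /m mxE c0 ?memW ?inordK //.
Qed.

End Representations.

Theorem theorem4 (K : closedFieldType) (charK : [pchar K] =i pred0) :
  (forall (V : vectType K) (rho : B3 -> 'End(V)) (W : {vspace V})
          (e : 3.-tuple V),
     is_representation rho ->
     \dim {:V} = 3%N ->
     strictly_indecomposable rho ->
     min_invariant rho W ->
     \dim W = 2%N ->
     basis_of {:V} e ->
     let AB := (end_mx e (rho sigma1), end_mx e (rho sigma2)) in
     [\/ exists l1 l2 l3 : K,
           cond1 l1 l2 l3 /\ equivalent_pairs AB (form1 l1 l2 l3),
         exists l1 l2 : K,
           cond2 l1 l2 /\ equivalent_pairs AB (form2 l1 l2)
       | exists l1 l2 : K,
           cond3 l1 l2 /\ equivalent_pairs AB (form3 l1 l2)]) /\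
  [/\ forall l1 l2 l3 : K, cond1 l1 l2 l3 ->
        equivalent_pairs (form1 l1 l2 l3) (form1' l1 l2 l3),
      forall l1 l2 : K, cond2 l1 l2 ->
        equivalent_pairs (form2 l1 l2) (form2' l1 l2)
    & forall l1 l2 : K, cond3 l1 l2 ->
        equivalent_pairs (form3 l1 l2) (form3' l1 l2)].
Proof.
have two0 : 2 != 0 :> K by move/pcharf0P: charK => ->.
have three0 : 3 != 0 :> K by move/pcharf0P: charK => ->.
split; last first.
  split; [exact: form1_form1' | exact: form2_form2' |].
  by move=> l1 l2; apply: form3_form3'.
move=> V rho W e rep dV _ [[W1 W2] _ minW] dW he AB.
have line0 u : Defs.invariant rho <[u]>%VS -> u = 0.
  move=> /minW h; apply/eqP/negPn/negP=> u0.
  have : (\dim W <= \dim <[u]>)%N by apply: h; rewrite -dimv_eq0 dim_vline u0.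
  by rewrite dW dim_vline u0.
have [b hb planeb] := invariant_plane_basis dV dW.
have eb := end_mx_change (rho sigma1) (rho sigma2) he hb.
have := end_mx_admissible rep hb line0.
move: eb; rewrite -/AB.
have [a1 [b1 [c1 [d1 [u1 [v1 [r1 ->]]]]]]] := planeb _ W1.
have [a2 [b2 [c2 [d2 [u2 [v2 [r2 ->]]]]]]] := planeb _ W2.
move=> e1 ad1; have [p [q [a [b' [c [d e2]]]]]] := admissible_normal_form ad1.
have ad2 := admissible_equiv e2 ad1.
have e3 := equivalent_pairs_trans e1 e2.
case: (classification two0 three0 ad2)
  => [[l1 [l2 [l3 [cl e4]]]]|[l1 [l2 [cl e4]]]|[l1 [l2 [cl e4]]]].
- constructor 1; exists l1, l2, l3; split=> //.
  exact: equivalent_pairs_trans e3 e4.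
- constructor 2; exists l1, l2; split=> //.
  exact: equivalent_pairs_trans e3 e4.
- constructor 3; exists l1, l2; split=> //.
  exact: equivalent_pairs_trans e3 e4.
Qed.
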